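(* Let $(A,I)$ be a Dorroh pair of algebras and let $K\subseteq A\ltimes_d I$ be a subspace. Let $Z\subseteq B\subseteq A$, $J\subseteq I$ and the linear map $\varphi:J\to B/Z$ be constructed from $K$ as in the context. Then the following three assertions are equivalent: (1) $K$ is an ideal of $A\ltimes_d I$; (2) (a), (b) and (c) below hold; (3) (a), (b') and (c') below hold. Here: (a) $Z$ and $B$ are both ideals of $A$ (so $B/Z$ is a well-defined $A$-Algebra). (b) $J$ is an $A$-subAlgebra of $I$. (b') $J$ is an $A$-subbimodule of $I$. (c) $\varphi:J\to B/Z$ is an $A$-Algebra homomorphism, and if $\varphi(x)=a+Z$ then $ay-xy,\ ya-yx\in\mathrm{Ker}(\varphi)$ for any $y\in I$. (c') $\varphi:J\to B/Z$ is an $A$-bimodule homomorphism, and if $\varphi(x)=a+Z$ then $ay-xy,\ ya-yx\in\mathrm{Ker}(\varphi)$ for any $y\in I$.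
   Context: Everything is over a field $k$. Algebras are associative, not necessarily unital; modules over a unital algebra are assumed unital. Ideals are two-sided. $(A,I)$ is a Dorroh pair of algebras if $A$ and $I$ are algebras, $I$ is an $A$-bimodule, and $a(xy)=(ax)y$, $(xa)y=x(ay)$, $(xy)a=x(ya)$ for all $a\in A$, $x,y\in I$. Then $A\ltimes_d I=A\oplus I$ is an algebra with multiplication $(a,x)(b,y)=(ab,\,ay+xb+xy)$. An $A$-Algebra is an algebra $I$ with an $A$-bimodule structure such that $(A,I)$ is a Dorroh pair of algebras; an $A$-subAlgebra is a subspace that is both a subalgebra and an $A$-subbimodule; an $A$-Algebra homomorphism is a map that is both an algebra homomorphism and an $A$-bimodule homomorphism. If $Z\subseteq B$ are ideals of $A$, $B/Z$ is an $A$-Algebra via the multiplication of $A$. For a subspace $K\subseteq A\ltimes_d I$ put $B=\{a\in A\mid (a,x)\in K\text{ for some }x\in I\}$, $J=\{x\in I\mid (a,x)\in K\text{ for some }a\in A\}$, $Z=\{a\in A\mid (a,0)\in K\}$. Then $Z\subseteq B$, and $\varphi:J\to B/Z\subseteq A/Z$, $\varphi(x)=a+Z$ whenever $(a,-x)\in K$, is a well-defined surjective linear map. One has $K=\{(a,-x)\mid a\in B,\ x\in J,\ \varphi(x)=a+Z\}$. *)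

(* Defs.v *)
From HB Require Import structures.
From mathcomp Require Import all_boot all_algebra ssrAC.
From mathcomp Require Import boolp.

Set Implicit Arguments.
Unset Strict Implicit.
Unset Printing Implicit Defensive.

Import GRing.Theory.
Local Open Scope ring_scope.
Local Open Scope quotient_scope.

Reserved Notation "x ** y" (at level 40, left associativity).
Reserved Notation "a *> x" (at level 40, no associativity).
Reserved Notation "x <* a" (at level 40, no associativity).

(* Associative k-algebras, not necessarily unital. *)
HB.mixin Record Lmodule_isNUAlgebra (k : fieldType) A of GRing.Lmodule k A := {
  amul : A -> A -> A;
  amulA : associative amul;
  amul_linearl : forall y, linear (amul^~ y);
  amul_linearr : forall x, linear (amul x)
}.

#[short(type="nuAlgType")]
HB.structure Definition NUAlgebra (k : fieldType) :=
  {A of GRing.Lmodule k A & Lmodule_isNUAlgebra k A}.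

Notation "x ** y" := (amul x y) : ring_scope.

Definition is_identity (k : fieldType) (A : nuAlgType k) (e : A) : Prop :=
  forall a : A, e ** a = a /\ a ** e = a.

(* The last axiom says that bimodules over a unital algebra are unital; it is
   void when A has no identity element. *)
HB.mixin Record Lmodule_isBimodule (k : fieldType) (A : nuAlgType k) M
    of GRing.Lmodule k M := {
  lact : A -> M -> M;
  ract : M -> A -> M;
  lact_linearl : forall x, linear (lact^~ x);
  lact_linearr : forall a, linear (lact a);
  ract_linearl : forall a, linear (ract^~ a);
  ract_linearr : forall x, linear (ract x);
  lactA : forall a b x, lact (a ** b) x = lact a (lact b x);
  ractA : forall x a b, ract x (a ** b) = ract (ract x a) b;
  lractA : forall a x b, ract (lact a x) b = lact a (ract x b);
  bimod_unital : forall e, is_identity e ->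
    forall x, lact e x = x /\ ract x e = x
}.

#[short(type="bimodType")]
HB.structure Definition Bimodule (k : fieldType) (A : nuAlgType k) :=
  {M of GRing.Lmodule k M & Lmodule_isBimodule k A M}.

Notation "a *> x" := (lact a x) : ring_scope.
Notation "x <* a" := (ract x a) : ring_scope.

(* (A, I) is a Dorroh pair of algebras, i.e. I is an A-Algebra. *)
HB.mixin Record isDorroh (k : fieldType) (A : nuAlgType k) I
    of NUAlgebra k I & Bimodule k A I := {
  dorrohl : forall (a : A) (x y : I), a *> (x ** y) = (a *> x) ** y;
  dorrohm : forall (a : A) (x y : I), (x <* a) ** y = x ** (a *> y);
  dorrohr : forall (a : A) (x y : I), (x ** y) <* a = x ** (y <* a)
}.

#[short(type="aAlgType")]
HB.structure Definition AAlgebra (k : fieldType) (A : nuAlgType k) :=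
  {I of NUAlgebra k I & Bimodule k A I & isDorroh k A I}.

Section BilinearTheory.
Variables (k : fieldType) (A : nuAlgType k) (M : bimodType A).
Implicit Types (a b : A) (x y : M).

Lemma amulDl a b c : (a + b) ** c = a ** c + b ** c.
Proof. by have := amul_linearl c 1 a b; rewrite !scale1r. Qed.
Lemma amulDr a b c : a ** (b + c) = a ** b + a ** c.
Proof. by have := amul_linearr a 1 b c; rewrite !scale1r. Qed.
Lemma amul0l a : 0 ** a = 0.
Proof. by apply: (addrI (0 ** a)); rewrite -amulDl !addr0. Qed.
Lemma amul0r a : a ** 0 = 0.
Proof. by apply: (addrI (a ** 0)); rewrite -amulDr !addr0. Qed.
Lemma amulNl a b : (- a) ** b = - (a ** b).
Proof. by apply: (addrI (a ** b)); rewrite -amulDl !subrr amul0l. Qed.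
Lemma amulNr a b : a ** (- b) = - (a ** b).
Proof. by apply: (addrI (a ** b)); rewrite -amulDr !subrr amul0r. Qed.
Lemma amulZl s a b : (s *: a) ** b = s *: (a ** b).
Proof. by have := amul_linearl b s a 0; rewrite amul0l !addr0. Qed.
Lemma amulZr s a b : a ** (s *: b) = s *: (a ** b).
Proof. by have := amul_linearr a s b 0; rewrite amul0r !addr0. Qed.

Lemma lactDl a b x : (a + b) *> x = a *> x + b *> x.
Proof. by have := lact_linearl x 1 a b; rewrite !scale1r. Qed.
Lemma lactDr a x y : a *> (x + y) = a *> x + a *> y.
Proof. by have := lact_linearr a 1 x y; rewrite !scale1r. Qed.
Lemma lact0l x : 0 *> x = 0 :> M.
Proof. by apply: (addrI ((0 : A) *> x)); rewrite -lactDl !addr0. Qed.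
Lemma lact0r a : a *> 0 = 0 :> M.
Proof. by apply: (addrI (a *> 0)); rewrite -lactDr !addr0. Qed.
Lemma lactNl a x : (- a) *> x = - (a *> x).
Proof. by apply: (addrI (a *> x)); rewrite -lactDl !subrr lact0l. Qed.
Lemma lactNr a x : a *> (- x) = - (a *> x).
Proof. by apply: (addrI (a *> x)); rewrite -lactDr !subrr lact0r. Qed.
Lemma lactZl s a x : (s *: a) *> x = s *: (a *> x).
Proof. by have := lact_linearl x s a 0; rewrite lact0l !addr0. Qed.
Lemma lactZr s a x : a *> (s *: x) = s *: (a *> x).
Proof. by have := lact_linearr a s x 0; rewrite lact0r !addr0. Qed.

Lemma ractDl x y a : (x + y) <* a = x <* a + y <* a.
Proof. by have := ract_linearl a 1 x y; rewrite !scale1r. Qed.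
Lemma ractDr x a b : x <* (a + b) = x <* a + x <* b.
Proof. by have := ract_linearr x 1 a b; rewrite !scale1r. Qed.
Lemma ract0l a : 0 <* a = 0 :> M.
Proof. by apply: (addrI (0 <* a)); rewrite -ractDl !addr0. Qed.
Lemma ract0r x : x <* (0 : A) = 0.
Proof. by apply: (addrI (x <* (0 : A))); rewrite -ractDr !addr0. Qed.
Lemma ractNl x a : (- x) <* a = - (x <* a).
Proof. by apply: (addrI (x <* a)); rewrite -ractDl !subrr ract0l. Qed.
Lemma ractNr x a : x <* (- a) = - (x <* a).
Proof. by apply: (addrI (x <* a)); rewrite -ractDr !subrr ract0r. Qed.
Lemma ractZl s x a : (s *: x) <* a = s *: (x <* a).
Proof. by have := ract_linearl a s x 0; rewrite ract0l !addr0. Qed.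
Lemma ractZr s x a : x <* (s *: a) = s *: (x <* a).
Proof. by have := ract_linearr x s a 0; rewrite ract0r !addr0. Qed.

End BilinearTheory.

Section Predicates.
Variables (k : fieldType) (A : nuAlgType k).

Definition is_ideal (S : {pred A}) : Prop :=
  [/\ submod_closed S,
      forall a x, x \in S -> a ** x \in S
    & forall a x, x \in S -> x ** a \in S].

Definition is_subalgebra (S : {pred A}) : Prop :=
  submod_closed S /\ {in S &, forall x y, x ** y \in S}.

Definition is_subbimodule (M : bimodType A) (S : {pred M}) : Prop :=
  [/\ submod_closed S,
      forall (a : A) x, x \in S -> a *> x \in S
    & forall (a : A) x, x \in S -> x <* a \in S].

Definition is_alg_hom (B : nuAlgType k) (f : A -> B) : Prop :=
  linear f /\ {morph f : x y / x ** y}.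

Definition is_bimod_hom (M N : bimodType A) (f : M -> N) : Prop :=
  [/\ linear f,
      forall (a : A) x, f (a *> x) = a *> f x
    & forall (a : A) x, f (x <* a) = f x <* a].

End Predicates.

Section AAlgebraPredicates.
Variables (k : fieldType) (A : nuAlgType k).

Definition is_subAAlgebra (I : aAlgType A) (S : {pred I}) : Prop :=
  is_subalgebra S /\ is_subbimodule S.

Definition is_AAlg_hom (I I' : aAlgType A) (f : I -> I') : Prop :=
  is_alg_hom f /\ is_bimod_hom f.

End AAlgebraPredicates.

Section DorrohExtension.
Variables (k : fieldType) (A : nuAlgType k) (I : aAlgType A).

Definition dorroh_ext : Type := (A * I)%type.

HB.instance Definition _ := GRing.Lmodule.on dorroh_ext.

Definition dorroh_mul (u v : dorroh_ext) : dorroh_ext :=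
  (u.1 ** v.1, u.1 *> v.2 + u.2 <* v.1 + u.2 ** v.2).

Fact dorroh_mulA : associative dorroh_mul.
Proof.
move=> [a x] [b y] [c z]; rewrite /dorroh_mul /= amulA; congr (_, _).
rewrite !lactDr !ractDl !amulDl !amulDr lactA ractA lractA dorrohl dorrohm.
by rewrite dorrohr amulA !addrA [LHS](ACl (1*2*4*6*3*5*7)).
Qed.

Fact dorroh_mul_linearl v : linear (dorroh_mul^~ v).
Proof.
case: v => c z s [a x] [b y]; rewrite /dorroh_mul /=.
rewrite !amulDl lactDl ractDl !amulZl lactZl ractZl.
by congr (_, _); rewrite /= !scalerDr !addrA [LHS](ACl (1*3*5*2*4*6)).
Qed.

Fact dorroh_mul_linearr u : linear (dorroh_mul u).
Proof.
case: u => c z s [a x] [b y]; rewrite /dorroh_mul /=.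
rewrite !amulDr lactDr ractDr !amulZr lactZr ractZr.
by congr (_, _); rewrite /= !scalerDr !addrA [LHS](ACl (1*3*5*2*4*6)).
Qed.

HB.instance Definition _ := Lmodule_isNUAlgebra.Build k dorroh_ext
  dorroh_mulA dorroh_mul_linearl dorroh_mul_linearr.

End DorrohExtension.

(* Subspaces are boolean predicates, as in submodClosed; since boolp decides
   every proposition, this covers all subsets. *)
Section Subspaces.
Variables (k : fieldType) (V : lmodType k).

Definition subspace (S : submodClosed V) : Type := {x : V | x \in S}.

Section Lmodule.
Variable S : submodClosed V.
HB.instance Definition _ := SubType.on (subspace S).
HB.instance Definition _ := Choice.on (subspace S).
HB.instance Definition _ := [SubChoice_isSubLmodule of subspace S by <:].
End Lmodule.

Lemma subspaceP (S : submodClosed V) (x : subspace S) : val x \in S.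
Proof. exact: valP. Qed.

(* The kernel of a map defined on a subspace S of V, as a subset of V. *)
Definition in_ker (S : submodClosed V) (W : zmodType) (f : subspace S -> W)
  (v : V) : Prop := exists2 x : subspace S, val x = v & f x = 0.

End Subspaces.

Section SubQuotients.
Variables (k : fieldType) (V : lmodType k).
Variables (B Z : submodClosed V).

(* The subspace B :&: Z of B; it is a copy of Z when Z is contained in B. *)
Definition subtrace : {pred subspace B} := [pred b | val b \in Z].

Fact subtrace_submod : submod_closed subtrace.
Proof.
split=> [|c u v]; rewrite !inE; first by rewrite GRing.val0 rpred0.
by move=> uZ vZ; rewrite GRing.valD GRing.valZ rpredD ?rpredZ.
Qed.

HB.instance Definition _ :=
  GRing.isSubmodClosed.Build k (subspace B) subtrace subtrace_submod.

(* The vector space B / Z. *)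
Definition subquot : Type := {ideal_quot subtrace}.

HB.instance Definition _ := GRing.Zmodule.on subquot.

Definition qclass (b : subspace B) : subquot := \pi_({ideal_quot subtrace}) b.

Lemma qclassP (b c : subspace B) :
  reflect (qclass b = qclass c) (val b - val c \in Z).
Proof.
rewrite -GRing.valB; apply: (equivP idP).
by rewrite -[_ \in Z]/(b - c \in subtrace) Quotient.idealrBE; split=> /eqP.
Qed.

Definition qrepr (q : subquot) : subspace B := repr (q : {ideal_quot subtrace}).

Lemma qreprK : cancel qrepr qclass.
Proof. by move=> q; rewrite /qclass reprK. Qed.

Lemma qclassD : {morph qclass : x y / x + y}.
Proof. by move=> x y; rewrite /qclass Quotient.pi_add. Qed.

Definition qscale (s : k) (q : subquot) : subquot := qclass (s *: qrepr q).

Lemma qclassZ s b : qclass (s *: b) = qscale s (qclass b).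
Proof.
apply/qclassP; rewrite !GRing.valZ -scalerBr rpredZ //.
by apply/qclassP; rewrite qreprK.
Qed.

Fact qscaleA s t q : qscale s (qscale t q) = qscale (s * t) q.
Proof. by rewrite -[q]qreprK -!qclassZ scalerA. Qed.
Fact qscale1 : left_id 1 qscale.
Proof. by move=> q; rewrite -[q]qreprK -qclassZ scale1r. Qed.
Fact qscaleDr : right_distributive qscale +%R.
Proof.
move=> s q r; rewrite -[q]qreprK -[r]qreprK -qclassD -!qclassZ -qclassD.
by rewrite scalerDr.
Qed.
Fact qscaleDl q : {morph qscale^~ q : s t / s + t}.
Proof.
by move=> s t; rewrite -[q]qreprK /= -!qclassZ -qclassD scalerDl.
Qed.

HB.instance Definition _ := GRing.Zmodule_isLmodule.Build k subquot
  qscaleA qscale1 qscaleDr qscaleDl.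

Lemma qclass_linear : linear qclass.
Proof. by move=> s x y; rewrite qclassD qclassZ. Qed.

End SubQuotients.

Section SubBimodule.
Variables (k : fieldType) (A : nuAlgType k) (M : bimodType A).
Variables (S : submodClosed M) (hS : is_subbimodule S).

Definition sub_bimod of is_subbimodule S : Type := subspace S.

Local Notation T := (sub_bimod hS).

HB.instance Definition _ := GRing.Lmodule.on T.

Let vl : T -> M := fun x => val (x : subspace S).

Fact sub_lact_subproof (a : A) (x : T) : a *> vl x \in S.
Proof. by case: hS => _ h _; apply/h/subspaceP. Qed.
Fact sub_ract_subproof (x : T) (a : A) : vl x <* a \in S.
Proof. by case: hS => _ _ h; apply/h/subspaceP. Qed.

Definition sub_lact (a : A) (x : T) : T :=
  (Sub (a *> vl x) (sub_lact_subproof a x) : subspace S).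
Definition sub_ract (x : T) (a : A) : T :=
  (Sub (vl x <* a) (sub_ract_subproof x a) : subspace S).

Let vl_inj : injective vl. Proof. exact: val_inj. Qed.
Let vlP s x y : vl (s *: x + y) = s *: vl x + vl y.
Proof. by rewrite /vl GRing.valD GRing.valZ. Qed.
Let vll a x : vl (sub_lact a x) = a *> vl x. Proof. by rewrite /vl SubK. Qed.
Let vlr x a : vl (sub_ract x a) = vl x <* a. Proof. by rewrite /vl SubK. Qed.

Fact sub_lact_linearl x : linear (sub_lact^~ x).
Proof. by move=> s a b; apply: vl_inj; rewrite vlP !vll lactDl lactZl. Qed.
Fact sub_lact_linearr a : linear (sub_lact a).
Proof. by move=> s x y; apply: vl_inj; rewrite vlP !vll vlP lactDr lactZr. Qed.
Fact sub_ract_linearl a : linear (sub_ract^~ a).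
Proof. by move=> s x y; apply: vl_inj; rewrite vlP !vlr vlP ractDl ractZl. Qed.
Fact sub_ract_linearr x : linear (sub_ract x).
Proof. by move=> s a b; apply: vl_inj; rewrite vlP !vlr ractDr ractZr. Qed.
Fact sub_lactA a b x : sub_lact (a ** b) x = sub_lact a (sub_lact b x).
Proof. by apply: vl_inj; rewrite !vll lactA. Qed.
Fact sub_ractA x a b : sub_ract x (a ** b) = sub_ract (sub_ract x a) b.
Proof. by apply: vl_inj; rewrite !vlr ractA. Qed.
Fact sub_lractA a x b : sub_ract (sub_lact a x) b = sub_lact a (sub_ract x b).
Proof. by apply: vl_inj; rewrite vlr !vll vlr lractA. Qed.
Fact sub_unital e : is_identity e ->
  forall x, sub_lact e x = x /\ sub_ract x e = x.
Proof.
move=> e1 x; have [el er] := bimod_unital e e1 (vl x).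
by split; apply: vl_inj; rewrite (vll, vlr).
Qed.

HB.instance Definition _ := Lmodule_isBimodule.Build k A T
  sub_lact_linearl sub_lact_linearr sub_ract_linearl sub_ract_linearr
  sub_lactA sub_ractA sub_lractA sub_unital.

End SubBimodule.

Section SubAAlgebra.
Variables (k : fieldType) (A : nuAlgType k) (I : aAlgType A).
Variables (S : submodClosed I) (hS : is_subAAlgebra S).

Definition sub_AAlg (h : is_subAAlgebra S) : Type := sub_bimod (proj2 h).

Local Notation T := (sub_AAlg hS).

HB.instance Definition _ := Bimodule.on T.

Let vl : T -> I := fun x => val (x : subspace S).

Fact sub_mul_subproof (x y : T) : vl x ** vl y \in S.
Proof. by case: hS => -[_ h] _; apply: h; apply: subspaceP. Qed.

Definition sub_mul (x y : T) : T :=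
  (Sub (vl x ** vl y) (sub_mul_subproof x y) : subspace S).

Let vl_inj : injective vl. Proof. exact: val_inj. Qed.
Let vlP s x y : vl (s *: x + y) = s *: vl x + vl y.
Proof. by rewrite /vl GRing.valD GRing.valZ. Qed.
Let vlm x y : vl (sub_mul x y) = vl x ** vl y.
Proof. by rewrite /vl SubK. Qed.
Let vll (a : A) x : vl (a *> x) = a *> vl x. Proof. by rewrite /vl SubK. Qed.
Let vlr x (a : A) : vl (x <* a) = vl x <* a. Proof. by rewrite /vl SubK. Qed.

Fact sub_mulA : associative sub_mul.
Proof. by move=> x y z; apply: vl_inj; rewrite !vlm amulA. Qed.
Fact sub_mul_linearl y : linear (sub_mul^~ y).
Proof. by move=> s x z; apply: vl_inj; rewrite vlP !vlm vlP amulDl amulZl. Qed.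
Fact sub_mul_linearr x : linear (sub_mul x).
Proof. by move=> s y z; apply: vl_inj; rewrite vlP !vlm vlP amulDr amulZr. Qed.

HB.instance Definition _ := Lmodule_isNUAlgebra.Build k T
  sub_mulA sub_mul_linearl sub_mul_linearr.

Fact sub_dorrohl (a : A) (x y : T) : a *> (x ** y) = (a *> x) ** y.
Proof. by apply: vl_inj; rewrite vll !vlm vll dorrohl. Qed.
Fact sub_dorrohm (a : A) (x y : T) : (x <* a) ** y = x ** (a *> y).
Proof. by apply: vl_inj; rewrite !vlm vlr vll dorrohm. Qed.
Fact sub_dorrohr (a : A) (x y : T) : (x ** y) <* a = x ** (y <* a).
Proof. by apply: vl_inj; rewrite vlr !vlm vlr dorrohr. Qed.

HB.instance Definition _ := isDorroh.Build k A T
  sub_dorrohl sub_dorrohm sub_dorrohr.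

End SubAAlgebra.

(* B / Z as an A-Algebra, for ideals B and Z of A: the operations are those of
   A on representatives (lemmas ideal_quot_mulE, ideal_quot_lactE, ideal_quot_ractE). *)
Section IdealQuotient.
Variables (k : fieldType) (A : nuAlgType k) (B Z : submodClosed A).
Variables (hB : is_ideal B) (hZ : is_ideal Z).

Definition ideal_quot of is_ideal B & is_ideal Z : Type := subquot B Z.

Local Notation Q := (ideal_quot hB hZ).
Implicit Types (a : A) (b c : subspace B) (q r : Q).

HB.instance Definition _ := GRing.Lmodule.on Q.

Fact ideal_lact_subproof a b : a ** val b \in B.
Proof. by case: hB => _ h _; apply/h/subspaceP. Qed.
Fact ideal_ract_subproof b a : val b ** a \in B.
Proof. by case: hB => _ _ h; apply/h/subspaceP. Qed.

Definition ideal_lact a b : subspace B :=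
  Sub (a ** val b) (ideal_lact_subproof a b).
Definition ideal_ract b a : subspace B :=
  Sub (val b ** a) (ideal_ract_subproof b a).

Let cl b : Q := qclass Z b.
Let rp q : subspace B := qrepr (q : subquot B Z).
Let clK q : cl (rp q) = q. Proof. exact: qreprK. Qed.
Let clP s b c : cl (s *: b + c) = s *: cl b + cl c.
Proof. exact: qclass_linear. Qed.
Let clE b c : val b - val c \in Z -> cl b = cl c.
Proof. by move/qclassP. Qed.
Let rpE b : val (rp (cl b)) - val b \in Z.
Proof. by apply/qclassP; rewrite /rp qreprK. Qed.

Definition ideal_quot_mul q r : Q := cl (ideal_lact (val (rp q)) (rp r)).
Definition ideal_quot_lact a q : Q := cl (ideal_lact a (rp q)).
Definition ideal_quot_ract q a : Q := cl (ideal_ract (rp q) a).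

Let vl a b : val (ideal_lact a b) = a ** val b. Proof. by rewrite SubK. Qed.
Let vr b a : val (ideal_ract b a) = val b ** a. Proof. by rewrite SubK. Qed.
Let vP s b c : val (s *: b + c) = s *: val b + val c.
Proof. by rewrite GRing.valD GRing.valZ. Qed.

Let lactcl a b : ideal_quot_lact a (cl b) = cl (ideal_lact a b).
Proof.
by have [[_ h _] bZ] := (hZ, rpE b); apply: clE; rewrite !vl -amulNr -amulDr h.
Qed.
Let ractcl b a : ideal_quot_ract (cl b) a = cl (ideal_ract b a).
Proof.
by have [[_ _ h] bZ] := (hZ, rpE b); apply: clE; rewrite !vr -amulNl -amulDl h.
Qed.
Let mulcl b c : ideal_quot_mul (cl b) (cl c) = cl (ideal_lact (val b) c).
Proof.
have [[_ hl hr] bZ cZ] := And3 hZ (rpE b) (rpE c); apply: clE; rewrite !vl.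
rewrite -(subrKA (val b ** val (rp (cl c)))) rpredD //.
  by rewrite -amulNl -amulDl hr.
by rewrite -amulNr -amulDr hl.
Qed.

Fact ideal_quot_lact_linearl q : linear (ideal_quot_lact^~ q).
Proof.
move=> s a b; rewrite -[q]clK /= !lactcl -clP; congr cl; apply: val_inj.
by rewrite vP !vl amulDl amulZl.
Qed.
Fact ideal_quot_lact_linearr a : linear (ideal_quot_lact a).
Proof.
move=> s q r; rewrite -[q]clK -[r]clK -clP !lactcl -clP; congr cl.
by apply: val_inj; rewrite vP !vl vP amulDr amulZr.
Qed.
Fact ideal_quot_ract_linearl a : linear (ideal_quot_ract^~ a).
Proof.
move=> s q r; rewrite -[q]clK -[r]clK -clP /= !ractcl -clP; congr cl.
by apply: val_inj; rewrite vP !vr vP amulDl amulZl.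
Qed.
Fact ideal_quot_ract_linearr q : linear (ideal_quot_ract q).
Proof.
move=> s a b; rewrite -[q]clK !ractcl -clP; congr cl; apply: val_inj.
by rewrite vP !vr amulDr amulZr.
Qed.
Fact ideal_quot_lactA a (b : A) q :
  ideal_quot_lact (a ** b) q = ideal_quot_lact a (ideal_quot_lact b q).
Proof.
rewrite -[q]clK !lactcl; congr cl; apply: val_inj.
by rewrite !vl amulA.
Qed.
Fact ideal_quot_ractA q a (b : A) :
  ideal_quot_ract q (a ** b) = ideal_quot_ract (ideal_quot_ract q a) b.
Proof.
rewrite -[q]clK !ractcl; congr cl; apply: val_inj.
by rewrite !vr amulA.
Qed.
Fact ideal_quot_lractA a q (b : A) :
  ideal_quot_ract (ideal_quot_lact a q) b =
  ideal_quot_lact a (ideal_quot_ract q b).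
Proof.
rewrite -[q]clK !(lactcl, ractcl); congr cl; apply: val_inj.
by rewrite vr !vl vr amulA.
Qed.
Fact ideal_quot_unital e : is_identity e ->
  forall q, ideal_quot_lact e q = q /\ ideal_quot_ract q e = q.
Proof.
move=> e1 q; rewrite -[q]clK lactcl ractcl.
by split; congr cl; apply: val_inj; rewrite (vl, vr); case: (e1 (val (rp q))).
Qed.

HB.instance Definition _ := Lmodule_isBimodule.Build k A Q
  ideal_quot_lact_linearl ideal_quot_lact_linearr
  ideal_quot_ract_linearl ideal_quot_ract_linearr
  ideal_quot_lactA ideal_quot_ractA ideal_quot_lractA ideal_quot_unital.

Fact ideal_quot_mulA : associative ideal_quot_mul.
Proof.
move=> p q r; rewrite -[p]clK -[q]clK -[r]clK !mulcl; congr cl.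
by apply: val_inj; rewrite !vl amulA.
Qed.
Fact ideal_quot_mul_linearl r : linear (ideal_quot_mul^~ r).
Proof.
move=> s p q; rewrite -[p]clK -[q]clK -[r]clK -clP /= !mulcl -clP; congr cl.
by apply: val_inj; rewrite vP !vl vP amulDl amulZl.
Qed.
Fact ideal_quot_mul_linearr p : linear (ideal_quot_mul p).
Proof.
move=> s q r; rewrite -[p]clK -[q]clK -[r]clK -clP !mulcl -clP; congr cl.
by apply: val_inj; rewrite vP !vl vP amulDr amulZr.
Qed.

HB.instance Definition _ := Lmodule_isNUAlgebra.Build k Q
  ideal_quot_mulA ideal_quot_mul_linearl ideal_quot_mul_linearr.

Lemma ideal_quot_mulE b c :
  (qclass Z b : Q) ** (qclass Z c : Q) = qclass Z (ideal_lact (val b) c).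
Proof. exact: mulcl. Qed.
Lemma ideal_quot_lactE a b :
  a *> (qclass Z b : Q) = qclass Z (ideal_lact a b).
Proof. exact: lactcl. Qed.
Lemma ideal_quot_ractE b a :
  (qclass Z b : Q) <* a = qclass Z (ideal_ract b a).
Proof. exact: ractcl. Qed.

Let mE b c : cl b ** cl c = cl (ideal_lact (val b) c).
Proof. exact: mulcl. Qed.
Let lE a b : a *> cl b = cl (ideal_lact a b). Proof. exact: lactcl. Qed.
Let rE b a : cl b <* a = cl (ideal_ract b a). Proof. exact: ractcl. Qed.

Fact ideal_quot_dorrohl a q r : a *> (q ** r) = (a *> q) ** r.
Proof.
rewrite -[q]clK -[r]clK !(mE, lE); congr cl; apply: val_inj.
by rewrite !vl amulA.
Qed.
Fact ideal_quot_dorrohm a q r : (q <* a) ** r = q ** (a *> r).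
Proof.
rewrite -[q]clK -[r]clK lE rE !mE; congr cl; apply: val_inj.
by rewrite !vl vr amulA.
Qed.
Fact ideal_quot_dorrohr a q r : (q ** r) <* a = q ** (r <* a).
Proof.
rewrite -[q]clK -[r]clK rE !mE rE; congr cl; apply: val_inj.
by rewrite vr !vl vr amulA.
Qed.

HB.instance Definition _ := isDorroh.Build k A Q
  ideal_quot_dorrohl ideal_quot_dorrohm ideal_quot_dorrohr.

End IdealQuotient.

Section DorrohSubspace.
Variables (k : fieldType) (A : nuAlgType k) (I : aAlgType A).
Variable K : submodClosed (dorroh_ext I).

Definition in_dorroh (a : A) (x : I) : bool := ((a, x) : dorroh_ext I) \in K.

Definition dorroh_B : {pred A} := [pred a | `[< exists x : I, in_dorroh a x >]].
Definition dorroh_J : {pred I} := [pred x | `[< exists a : A, in_dorroh a x >]].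
Definition dorroh_Z : {pred A} := [pred a | in_dorroh a 0].

Let inP s a x b y : in_dorroh a x -> in_dorroh b y ->
  in_dorroh (s *: a + b) (s *: x + y).
Proof.
rewrite /in_dorroh => aK bK; have := rpredD (rpredZ s aK) bK.
exact.
Qed.

Fact dorroh_B_submod : submod_closed dorroh_B.
Proof.
split=> [|s a b]; first by apply/asboolP; exists 0; apply: rpred0.
move=> /asboolP[x ax] /asboolP[y bK]; apply/asboolP.
by exists (s *: x + y); apply: inP.
Qed.
Fact dorroh_J_submod : submod_closed dorroh_J.
Proof.
split=> [|s x y]; first by apply/asboolP; exists 0; apply: rpred0.
move=> /asboolP[a ax] /asboolP[b bK]; apply/asboolP.
by exists (s *: a + b); apply: inP.
Qed.
Fact dorroh_Z_submod : submod_closed dorroh_Z.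
Proof.
split=> [|s a b]; first exact: rpred0.
move=> aZ bZ; have := inP s aZ bZ.
by rewrite scaler0 addr0.
Qed.

HB.instance Definition _ :=
  GRing.isSubmodClosed.Build k A dorroh_B dorroh_B_submod.
HB.instance Definition _ :=
  GRing.isSubmodClosed.Build k I dorroh_J dorroh_J_submod.
HB.instance Definition _ :=
  GRing.isSubmodClosed.Build k A dorroh_Z dorroh_Z_submod.

Lemma dorroh_sub_ZB : {subset dorroh_Z <= dorroh_B}.
Proof. by move=> a aZ; apply/asboolP; exists 0. Qed.

Fact dorroh_phi_subproof (x : subspace dorroh_J) :
  exists a : subspace dorroh_B, in_dorroh (val a) (- val x).
Proof.
have /asboolP[a ax] := subspaceP x.
have nax : in_dorroh (- a) (- val x) 
  by have := rpredZ (-1) ax; rewrite scaleN1r; apply.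
have aB : - a \in dorroh_B by apply/asboolP; exists (- val x).
by exists (Sub (- a) aB); rewrite SubK.
Qed.

(* phi x = a + Z for any a with (a, - x) in K; dorroh_phiP shows that the
   choice of a is immaterial. *)
Definition dorroh_phi (x : subspace dorroh_J) : subquot dorroh_B dorroh_Z :=
  qclass dorroh_Z (projT1 (cid (dorroh_phi_subproof x))).

Lemma dorroh_phiP (x : subspace dorroh_J) (a : subspace dorroh_B) :
  dorroh_phi x = qclass dorroh_Z a <-> in_dorroh (val a) (- val x).
Proof.
rewrite /dorroh_phi; case: cid => b /= bx; split=> [/qclassP|] h.
  have := inP (-1) h bx; rewrite scaler0 add0r scaleN1r opprB.
  by rewrite subrK.
apply/qclassP; have := inP (-1) h bx.
by rewrite scaleN1r scaleN1r opprK subrr addrC.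
Qed.

Lemma dorroh_phi_linear : linear dorroh_phi.
Proof.
move=> s x y.
have [a /dorroh_phiP ax] := dorroh_phi_subproof x.
have [b /dorroh_phiP bK] := dorroh_phi_subproof y.
rewrite ax bK -qclass_linear; apply/dorroh_phiP.
rewrite !GRing.valD !GRing.valZ opprD -scalerN.
by apply: inP; apply/dorroh_phiP.
Qed.

Lemma dorroh_phi_surj q : exists x, dorroh_phi x = q.
Proof.
rewrite -[q]qreprK; have /asboolP[x ax] := subspaceP (qrepr q).
have xJ : - x \in dorroh_J.
  by rewrite rpredN; apply/asboolP; exists (val (qrepr q)).
by exists (Sub (- x) xJ); apply/dorroh_phiP; rewrite SubK opprK.
Qed.

Definition dorroh_ker_cond : Prop :=
  forall (x : subspace dorroh_J) (a : subspace dorroh_B),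
    dorroh_phi x = qclass dorroh_Z a -> forall y : I,
    in_ker dorroh_phi (val a *> y - val x ** y) /\
    in_ker dorroh_phi (y <* val a - y ** val x).

End DorrohSubspace.

Arguments dorroh_phi {k A I} K x.

(* Main.v *)
Require Import Defs.
From HB Require Import structures.
From mathcomp Require Import all_boot all_algebra.
From mathcomp Require Import boolp.

Set Implicit Arguments.
Unset Strict Implicit.
Unset Printing Implicit Defensive.

Import GRing.Theory.
Local Open Scope ring_scope.

(** Since (b, y)(a, x) = (b, 0)(a, x) + (0, y)(a, x), the subspace K is an ideal
    iff it is stable under multiplication by A and by I separately. Stability
    under A makes Z, B ideals, J a subbimodule and phi a bimodule map; stability
    under I is the kernel condition. Multiplicativity of phi is then automatic:
    if phi x = a + Z and phi y = b + Z, then ya - yx lies in Ker phi, so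
    phi (yx) = phi (ya) = (b + Z) a = (b + Z)(a + Z). *)

Section DorrohIdeals.
Variables (k : fieldType) (A : nuAlgType k) (I : aAlgType A).
Variable K : submodClosed (dorroh_ext I).

Local Notation D := (in_dorroh K).
Local Notation phi := (dorroh_phi K).

Lemma in_dorrohD a x b y : D a x -> D b y -> D (a + b) (x + y).
Proof. by rewrite /in_dorroh => aK bK; have := rpredD aK bK; apply. Qed.

Lemma in_dorrohN a x : D a x -> D (- a) (- x).
Proof. by move=> aK; have := rpredZ (-1) aK; rewrite scaleN1r; apply. Qed.

Lemma in_dorroh_B a x : D a x -> a \in dorroh_B K.
Proof. by move=> ax; apply/asboolP; exists x. Qed.

Lemma in_dorroh_J a x : D a x -> x \in dorroh_J K.
Proof. by move=> ax; apply/asboolP; exists a. Qed.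

(** Since [phi] reads off pairs of the form (a, - x), the hypotheses on [phi] are brought to bear on
    an arbitrary (a, x) in K through the point - x of J. *)
Lemma dorroh_phi_witness a x : D a x ->
  exists (x' : subspace (dorroh_J K)) (a' : subspace (dorroh_B K)),
    [/\ val x' = - x, val a' = a & phi x' = qclass (dorroh_Z K) a'].
Proof.
move=> ax; have Jx := in_dorroh_J ax; rewrite -rpredN in Jx.
exists (Sub (- x) Jx), (Sub a (in_dorroh_B ax)); rewrite !SubK; split=> //.
by apply/dorroh_phiP; rewrite !SubK opprK.
Qed.

Lemma dorroh_kerP v : in_ker phi v <-> D 0 v.
Proof.
have phi0 x : phi x = 0 <-> D 0 (- val x).
  (* [dorroh_phiP] compares [phi x] only with classes, so zero is first exhibited as one. *)
  have -> : 0 = qclass (dorroh_Z K) 0 :> subquot (dorroh_B K) (dorroh_Z K).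
    by apply: (addrI (qclass _ 0)); rewrite -qclassD !addr0.
  exact: dorroh_phiP.
split=> [[x <- /phi0 /in_dorrohN]|Dv]; first by rewrite oppr0 opprK.
exists (Sub v (in_dorroh_J Dv) : subspace (dorroh_J K)); first by rewrite SubK.
by apply/phi0; rewrite SubK -oppr0; apply: in_dorrohN.
Qed.

Definition dorroh_lstable : Prop :=
  forall a b x, D b x -> D (a ** b) (a *> x).
Definition dorroh_rstable : Prop :=
  forall a b x, D b x -> D (b ** a) (x <* a).
(** The pairs are the products (a, x)(0, y) and (0, y)(a, x), whose A-components vanish. *)
Definition dorroh_Istable : Prop := forall a x, D a x ->
  forall y, D 0 (a *> y + x ** y) /\ D 0 (y <* a + y ** x).

Lemma dorroh_idealP :
  is_ideal K <-> [/\ dorroh_lstable, dorroh_rstable & dorroh_Istable].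
Proof.
split=> [[_ hl hr]|[hl hr hI]].
  split=> [a b x bx|a b x bx|a x ax y].
  - have := hl (a, 0) (b, x) bx; rewrite /amul /= /dorroh_mul /=.
    by rewrite ract0l amul0l !addr0.
  - have := hr (a, 0) (b, x) bx; rewrite /amul /= /dorroh_mul /=.
    by rewrite lact0r amul0r add0r addr0.
  split.
    have := hr (0, y) (a, x) ax; rewrite /amul /= /dorroh_mul /=.
    by rewrite amul0r ract0r addr0.
  have := hl (0, y) (a, x) ax; rewrite /amul /= /dorroh_mul /=.
  by rewrite amul0l lact0l add0r.
split=> [|[b y] [a x] ax|[b y] [a x] ax].
- by split=> [|s u v uK vK]; [apply: rpred0|apply: rpredD; first apply: rpredZ].
- rewrite /amul /= /dorroh_mul /= -[b ** a]addr0 -addrA.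
  by apply: in_dorrohD; [apply: hl|case: (hI _ _ ax y)].
(* The swap brings x b to the front, so that (a, x)(b, 0) splits off from (a, x)(0, y). *)
- rewrite /amul /= /dorroh_mul /= -[a ** b]addr0 [a *> y + _]addrC -addrA.
  by apply: in_dorrohD; [apply: hr|case: (hI _ _ ax y)].
Qed.

(** Replacing x by - x turns the differences ay - xy and ya - yx into the sums of [dorroh_Istable];
    [dorroh_kerP] does the rest. *)
Lemma dorroh_ker_condP : dorroh_ker_cond K <-> dorroh_Istable.
Proof.
(* The anonymous assumption is the local definition of the unfolded
   [dorroh_ker_cond]. *)
split=> [hK a x ax y|hI _ x a /dorroh_phiP ax y]; last first.
  have [hl hr] := hI _ _ ax y.
  by rewrite -amulNl -amulNr; split; apply/dorroh_kerP.
have [x' [a' [ex ea e]]] := dorroh_phi_witness ax.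
have [] := hK _ _ e y; rewrite ex ea amulNl amulNr !opprK.
by move=> /dorroh_kerP + /dorroh_kerP.
Qed.

Lemma dorroh_Z_ideal :
  dorroh_lstable -> dorroh_rstable -> is_ideal (dorroh_Z K).
Proof.
move=> hl hr; split=> [|a z Dz|a z Dz]; first exact: dorroh_Z_submod.
  by have := hl a _ _ Dz; rewrite lact0r.
by have := hr a _ _ Dz; rewrite ract0l.
Qed.

Lemma dorroh_B_ideal :
  dorroh_lstable -> dorroh_rstable -> is_ideal (dorroh_B K).
Proof.
move=> hl hr; split=> [|a b /asboolP[x bx]|a b /asboolP[x bx]].
- exact: dorroh_B_submod.
- exact: in_dorroh_B (hl a _ _ bx).
- exact: in_dorroh_B (hr a _ _ bx).
Qed.

Lemma dorroh_J_subbimodule :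
  dorroh_lstable -> dorroh_rstable -> is_subbimodule (dorroh_J K).
Proof.
move=> hl hr; split=> [|a x /asboolP[b bx]|a x /asboolP[b bx]].
- exact: dorroh_J_submod.
- exact: in_dorroh_J (hl a _ _ bx).
- exact: in_dorroh_J (hr a _ _ bx).
Qed.

(** For y in J and (a, x) in K, both ya + yx and ya lie in J, hence so does yx. *)
Lemma dorroh_J_subAAlgebra :
    dorroh_lstable -> dorroh_rstable -> dorroh_Istable ->
  is_subAAlgebra (dorroh_J K).
Proof.
move=> hl hr hI; have hJ := dorroh_J_subbimodule hl hr; split=> //.
have [hS _ hJr] := hJ; split=> // y x yJ /asboolP[a ax].
have [_ /in_dorroh_J hyx] := hI _ _ ax y.
by move: hyx; rewrite rpredDl //; apply: hJr.
Qed.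

(** If [phi x] is the class of b, then by [dorroh_phiP] the equation phi (ax) = a (phi x) says that
    (ab, - ax) is in K, which is left stability at (b, - x); the right side is alike, and linearity
    always holds. *)
Lemma dorroh_phi_bimod_homP (hZ : is_ideal (dorroh_Z K))
    (hB : is_ideal (dorroh_B K)) (hJ : is_subbimodule (dorroh_J K)) :
  is_bimod_hom (phi : sub_bimod hJ -> ideal_quot hB hZ) <->
  dorroh_lstable /\ dorroh_rstable.
Proof.
split=> [[_ hl hr]|[hl hr]]; last first.
  split=> [|a x|a x]; first exact: dorroh_phi_linear.
    have /dorroh_phiP xq := esym (qreprK (phi x)).
    rewrite -[phi x]qreprK (ideal_quot_lactE hB hZ); apply/dorroh_phiP.
    by rewrite !SubK -lactNr; apply: hl.
  have /dorroh_phiP xq := esym (qreprK (phi x)).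
  rewrite -[phi x]qreprK (ideal_quot_ractE hB hZ); apply/dorroh_phiP.
  by rewrite !SubK -ractNl; apply: hr.
split=> a b x bx; have [x' [b' [ex eb e]]] := dorroh_phi_witness bx.
  have := hl a x'; rewrite e (ideal_quot_lactE hB hZ) => /dorroh_phiP.
  by rewrite !SubK ex eb lactNr opprK.
have := hr a x'; rewrite e (ideal_quot_ractE hB hZ) => /dorroh_phiP.
by rewrite !SubK ex eb ractNl opprK.
Qed.

Lemma dorroh_phiM (hZ : is_ideal (dorroh_Z K)) (hB : is_ideal (dorroh_B K))
    (hJ : is_subAAlgebra (dorroh_J K)) :
    dorroh_rstable -> dorroh_Istable ->
  {morph (phi : sub_AAlg hJ -> ideal_quot hB hZ) : x y / x ** y}.
Proof.
move=> hr hI y x.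
have /dorroh_phiP yq := esym (qreprK (phi y)).
have /dorroh_phiP xq := esym (qreprK (phi x)).
rewrite -[phi y]qreprK -[phi x]qreprK (ideal_quot_mulE hB hZ).
(* With b and a representing [phi y] and [phi x], the pair (ba, - yx) is the sum of (ba, - ya) and
   (0, ya - yx), both in K. *)
apply/dorroh_phiP; rewrite !SubK -[X in D X]addr0.
have [_] := hI _ _ xq (val (y : subspace (dorroh_J K))).
move=> /(in_dorrohD (hr (val (qrepr (phi x))) _ _ yq)).
by rewrite ractNl addKr amulNr.
Qed.

End DorrohIdeals.

(** The existentials act as dependent conjunctions: the structures on J and B/Z are built from the
    proofs of (a) and of (b) or (b'). *)
Theorem proposition2p1 (k : fieldType) (A : nuAlgType k) (I : aAlgType A)
    (K : submodClosed (dorroh_ext I)) :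
  [<-> is_ideal K;
       exists (hZ : is_ideal (dorroh_Z K)) (hB : is_ideal (dorroh_B K))
              (hJ : is_subAAlgebra (dorroh_J K)),
         is_AAlg_hom (dorroh_phi K : sub_AAlg hJ -> ideal_quot hB hZ) /\
         dorroh_ker_cond K;
       exists (hZ : is_ideal (dorroh_Z K)) (hB : is_ideal (dorroh_B K))
              (hJ : is_subbimodule (dorroh_J K)),
         is_bimod_hom (dorroh_phi K : sub_bimod hJ -> ideal_quot hB hZ) /\
         dorroh_ker_cond K].
Proof.
tfae=> [/dorroh_idealP[hl hr hI]||[hZ [hB [hJ [/dorroh_phi_bimod_homP[hl hr]]]]]].
- exists (dorroh_Z_ideal hl hr), (dorroh_B_ideal hl hr).
  exists (dorroh_J_subAAlgebra hl hr hI).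
  split; last exact/dorroh_ker_condP.
  split; last exact/dorroh_phi_bimod_homP.
  by split; [apply: dorroh_phi_linear|apply: dorroh_phiM].
- move=> [hZ [hB [hJ [[_ hphi] hK]]]].
  (* [sub_AAlg hJ] is by definition [sub_bimod (proj2 hJ)], so the bimodule half of the homomorphism
     condition carries over as it is. *)
  by exists hZ, hB, (proj2 hJ).
- by move=> /dorroh_ker_condP hI; apply/dorroh_idealP.
Qed.
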